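(* Let $d\ge1$ be an integer, $\mu>-\frac12$, $q>-2\mu-d$, let $0\le m\le n$ be integers, and let $\mathbf k\in\mathbb N_0^d$ with $|\mathbf k|=m$. Then, for every $x\in\mathbb R^d$ and $t>0$, $$\lim_{p\to\infty}p^m M_{\mathbf k,n}^{(p,q,\mu)}\!\left(\frac xp,\frac tp\right)=(-1)^{n-m}(n-m)!\;\mathsf L_{\mathbf k,n}^{q,\mu}(x,t).$$
   Context: Univariate polynomials: $M_n^{(p,q)}(x)=(-1)^n\frac{(1+x)^{p+q}}{x^q}\frac{d^n}{dx^n}\left(x^{n+q}(1+x)^{n-p-q}\right)$, a polynomial of degree at most $n$ in $x$. Laguerre polynomials: $L_n^{a}(x)=\frac{x^{-a}e^x}{n!}\frac{d^n}{dx^n}\left(x^{n+a}e^{-x}\right)$, $a>-1$. Unit ball: $\mathbb B^d=\{x\in\mathbb R^d:\|x\|\le1\}$, $\mathsf w_\mu(x)=(1-\|x\|^2)^{\mu-1/2}$. $\mathcal V_m^d(\mathbb B^d,\mathsf w_\mu)$ is the space of polynomials of degree at most $m$ in $d$ variables orthogonal to all polynomials of degree less than $m$ with respect to $\mathsf w_\mu(x)\,dx$ on $\mathbb B^d$ (normalized to a probability measure), and $\{P_{\mathbf k}^m:|\mathbf k|=m,\ \mathbf k\in\mathbb N_0^d\}$ is a fixed orthonormal basis of it (independent of $p$ and $q$). With $\alpha=\mu+\frac{d-1}{2}$, for $|\mathbf k|=m$, $0\le m\le n$, $$M_{\mathbf k,n}^{(p,q,\mu)}(x,t)=M_{n-m}^{(p-2\alpha-2m,\;q+2\alpha+2m)}(t)\;t^mP_{\mathbf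 k}^m\!\left(\frac{x}{t}\right)$$ and the Laguerre polynomials on the cone are $$\mathsf L_{\mathbf k,n}^{\beta,\mu}(x,t)=L_{n-m}^{2m+2\mu+\beta+d-1}(t)\;t^mP_{\mathbf k}^m\!\left(\frac xt\right).$$ *)

(* Defs.v *)
From HB Require Import structures.
From mathcomp Require Import all_boot all_order all_algebra.
(* The notations of mpoly clash with those of mathcomp-analysis. *)
From mathcomp Require Import -(notations) mpoly.
From mathcomp Require Import all_classical all_reals all_analysis.

Set Implicit Arguments.
Unset Strict Implicit.
Unset Printing Implicit Defensive.

Import Order.TTheory GRing.Theory Num.Theory.
Import numFieldNormedType.Exports.

Local Open Scope classical_set_scope.
Local Open Scope ring_scope.

Notation mpoly := mpoly.mpoly.
Notation multinom := mpoly.multinom.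
Notation bmultinom := mpoly.bmultinom.
Notation mdeg := mpoly.mdeg.
Notation meval := mpoly.meval.
Notation msize p := (mpoly.mmeasure mpoly.mdeg p).

(* Lebesgue measure on R^d = d.-tuple R: on R^0 it is the unit mass at the
   only point, on R^(d+1) the image of the product measure by (a, x) |-> a :: x;
   lebesgue_tuple_box below gives its value on boxes. *)

Section LebesgueTuple.
Context (R : realType).
Local Notation rT := (measurableTypeR R).

Definition tcons d (ax : rT * d.-tuple rT) : d.+1.-tuple rT :=
  [tuple of ax.1 :: ax.2].

Lemma measurable_tcons d : measurable_fun setT (@tcons d).
Proof. exact: (measurable_cons measurable_fst measurable_snd). Qed.

Section Step.
Variables (d : nat) (mu : {sigma_finite_measure set (d.-tuple rT) -> \bar R}).

Definition leb_cons : set (d.+1.-tuple rT) -> \bar R :=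
  pushforward (@lebesgue_measure R \x mu)%E (@tcons d).

Let leb_cons0 : leb_cons set0 = 0%E.
Proof. by rewrite /leb_cons /pushforward preimage_set0 measure0. Qed.

Let leb_cons_ge0 A : (0 <= leb_cons A)%E.
Proof. by rewrite /leb_cons /pushforward; exact: measure_ge0. Qed.

Let leb_cons_sigma_additive : semi_sigma_additive leb_cons.
Proof.
move=> F mF tF mUF; rewrite /leb_cons /pushforward preimage_bigcup.
apply: measure_semi_sigma_additive.
- by move=> n; rewrite -[X in measurable X]setTI; exact: measurable_tcons.
- apply/trivIsetP => /= i j _ _ ij; rewrite -preimage_setI.
  by move/trivIsetP : tF => /(_ _ _ _ _ ij) ->//; rewrite preimage_set0.
- rewrite -preimage_bigcup -[X in measurable X]setTI.
  exact: measurable_tcons.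
Qed.

HB.instance Definition _ := isMeasure.Build _ _ _
  leb_cons leb_cons0 leb_cons_ge0 leb_cons_sigma_additive.

Let leb_cons_sigma_finite : sigma_finite setT leb_cons.
Proof.
have /sigma_finiteP[F [TF ndF Foo]] := sigma_finiteT (@lebesgue_measure R).
have /sigma_finiteP[G [TG ndG Goo]] := sigma_finiteT mu.
pose u (x : d.+1.-tuple rT) : rT * d.-tuple rT := (thead x, [tuple of behead x]).
have uK : cancel (@tcons d) u.
  by case=> a x; rewrite /u /tcons; congr pair; apply/val_inj.
have mu_ : measurable_fun setT u.
  apply: measurable_fun_pair; first exact: measurable_tnth.
  exact: measurable_behead.
exists (fun n => u @^-1` (F n `*` G n)).
  rewrite -preimage_bigcup -[LHS](preimage_setT u); congr (_ @^-1` _).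
  rewrite -setXTT TF TG predeqE => -[x y]; split.
    move=> [/= [n _ Fnx] [k _ Gky]]; exists (maxn n k) => //; split.
    - by move: x Fnx; exact/subsetPset/ndF/leq_maxl.
    - by move: y Gky; exact/subsetPset/ndG/leq_maxr.
  by move=> [n _ []/= ? ?]; split; exists n.
move=> i; have [mFi Fi] := Foo i; have [mGi Gi] := Goo i; split.
  by rewrite -[X in measurable X]setTI; apply: mu_ => //; exact: measurableX.
rewrite /leb_cons /pushforward -comp_preimage.
rewrite (_ : u \o _ = id); last by apply/funext => y; exact: uK.
by rewrite preimage_id product_measure1E// lte_mul_pinfty// ge0_fin_numE.
Qed.

HB.instance Definition _ := Measure_isSigmaFinite.Build _ _ _
  leb_cons leb_cons_sigma_finite.

End Step.

Fixpoint lebesgue_tuple d : {sigma_finite_measure set (d.-tuple rT) -> \bar R} :=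
  match d with
  | 0 => \d_([tuple] : 0.-tuple rT)
  | d'.+1 => leb_cons (lebesgue_tuple d')
  end.

Lemma lebesgue_tuple_box d (A : 'I_d -> set rT) :
  (forall i, measurable (A i)) ->
  lebesgue_tuple d [set x | forall i, A i (tnth x i)] =
  (\prod_(i < d) lebesgue_measure (A i))%E.
Proof.
elim: d A => [|d IH] A mA.
  rewrite big_ord0 /= diracE mem_set //=; by case.
rewrite big_ord_recl /= /leb_cons /pushforward.
set B := [set x : d.-tuple rT | forall i, A (lift ord0 i) (tnth x i)].
have -> : @tcons d @^-1` [set x | forall i, A i (tnth x i)] = A ord0 `*` B.
  apply/seteqP; split => -[a x] /=.
    move=> H; split; first by have := H ord0.
    by move=> i; have := H (lift ord0 i); rewrite /tcons tnthS.
  move=> [Ha Hx] i; case: (unliftP ord0 i) => [j ->|->//].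
  by rewrite /tcons tnthS; exact: Hx.
have mB : measurable B.
  rewrite (_ : B = \bigcap_(i in [set: 'I_d])
      ((@tnth d rT)^~ i @^-1` A (lift ord0 i))); last first.
    by apply/seteqP; split => x /= H i; [move=> _|]; exact: H.
  apply: fin_bigcap_measurable => // i _.
  by rewrite -[X in measurable X]setTI; exact: measurable_tnth.
by rewrite product_measure1E //; congr (_ * _)%E; exact: IH.
Qed.

End LebesgueTuple.

Section Ball.
Context (R : realType) (d : nat).
Implicit Types (mu : R) (m : nat).

Definition sqnorm (x : d.-tuple R) : R := \sum_(i < d) tnth x i ^+ 2.

Definition unit_ball : set (d.-tuple R) := [set x | sqnorm x <= 1].

Definition ball_weight mu (x : d.-tuple R) : R := (1 - sqnorm x) `^ (mu - 2^-1).

Definition peval (f : mpoly d R) (x : d.-tuple R) : R := meval (tnth x) f.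

Definition ball_integral mu (g : d.-tuple R -> R) : R :=
  \int[lebesgue_tuple R d]_(x in unit_ball) (g x * ball_weight mu x).

Definition ball_inner mu (f g : mpoly d R) : R :=
  (ball_integral mu (fun=> 1))^-1 *
  ball_integral mu (fun x => peval f x * peval g x).

(* msize is the degree plus one (and msize 0 = 0). *)
Definition ball_orth_poly mu m (f : mpoly d R) : Prop :=
  (msize f <= m.+1)%N /\
  forall g : mpoly d R, (msize g <= m)%N -> ball_inner mu f g = 0.

(* Only the members P k with |k| = m are concerned. *)
Definition ball_orthonormal_basis mu m (P : multinom d -> mpoly d R) : Prop :=
  [/\ forall k, mdeg k = m -> ball_orth_poly mu m (P k),
      forall k l, mdeg k = m -> mdeg l = m ->
        ball_inner mu (P k) (P l) = (k == l)%:R &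
      forall f, ball_orth_poly mu m f ->
        exists c : multinom d -> R,
          f = \sum_(k : bmultinom d m.+1 | mdeg k == m) c k *: P k].

End Ball.

Section Cone.
Context (R : realType).

(* Rodrigues formulas; real powers make them meaningful for x > 0, the only
   range in which the polynomials are evaluated below. *)
Definition rodriguesM (n : nat) (p q x : R) : R :=
  (-1) ^+ n * ((1 + x) `^ (p + q) / x `^ q) *
  derive1n n (fun y : R => y `^ (n%:R + q) * (1 + y) `^ (n%:R - p - q)) x.

Definition laguerre (n : nat) (a x : R) : R :=
  x `^ (- a) * expR x / n`!%:R *
  derive1n n (fun y : R => y `^ (n%:R + a) * expR (- y)) x.

Context (d : nat).

Definition tdiv (x : d.-tuple R) (t : R) : d.-tuple R :=
  [tuple tnth x i / t | i < d].

(* t^m P_k(x/t) with m = |k|. *)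
Definition cone_harm (P : multinom d -> mpoly d R) (k : multinom d)
    (x : d.-tuple R) (t : R) : R :=
  t ^+ mdeg k * peval (P k) (tdiv x t).

Definition coneM (p q mu : R) P (k : multinom d) (n : nat)
    (x : d.-tuple R) (t : R) : R :=
  let m := mdeg k in
  let alpha := mu + (d%:R - 1) / 2 in
  rodriguesM (n - m) (p - 2 * alpha - 2 * m%:R) (q + 2 * alpha + 2 * m%:R) t *
  cone_harm P k x t.

Definition coneL (beta mu : R) P (k : multinom d) (n : nat)
    (x : d.-tuple R) (t : R) : R :=
  let m := mdeg k in
  laguerre (n - m) (2 * m%:R + 2 * mu + beta + d%:R - 1) t *
  cone_harm P k x t.

End Cone.

(* Main.v *)
(* Leibniz's rule applied to the Rodrigues formulas gives
   M_N^(p,q)(x) = (-1)^N sum_k C(N,k) ff(N+q, N-k) ff(N-p-q, k) x^k (1+x)^(N-k),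
   N! L_N^a(x) = sum_k C(N,k) ff(N+a, N-k) (-x)^k, ff the falling factorial.
   At x = t/p, ff(N-p-q, k) (t/p)^k tends to (-t)^k and 1 + t/p tends to 1, so
   the first sum converges to the second term by term. The factor
   t^m P_k(x/t) is homogeneous of degree m in (x, t), which absorbs p^m. *)
Require Import Defs.
From mathcomp Require Import all_boot all_order all_algebra.
From mathcomp Require Import all_classical all_reals all_analysis.
From mathcomp Require Import ring.
Import Order.TTheory GRing.Theory Num.Theory.
Import numFieldNormedType.Exports.
Local Open Scope classical_set_scope.
Local Open Scope ring_scope.

(** Derivatives are local and [D] is open, so the formula for the [n]-th derivative holds near each
    point of [D] and can be differentiated again. Working on [D] matters because the real powers
    below are differentiated only where their base is positive. *)
Lemma derive1n_seq {R : realType} {D : set R} (H : nat -> R -> R) :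
  open D -> (forall k x, D x -> is_derive x 1 (H k) (H k.+1 x)) ->
  forall n x, D x -> derive1n n (H 0%N) x = H n x.
Proof.
move=> oD dH; elim=> [//|n IHn] x Dx.
rewrite derive1nS derive1E (@near_eq_derive _ _ _ _ (H n)).
  by have [_ ->] := dH n x Dx.
by near=> y; apply: IHn; near: y; exact: open_nbhs_nbhs.
Unshelve. all: by end_near. Qed.

(** Pascal's rule, in the form needed for the inductive step of Leibniz's rule: [F] and [G] stand
    for the successive derivatives of two factors at one point. *)
Lemma binomial_sum_rec {R : pzRingType} (n : nat) (F G : nat -> R) :
  \sum_(k < n.+2) 'C(n.+1, k)%:R * (F (n.+1 - k)%N * G k) =
  \sum_(k < n.+1) 'C(n, k)%:R *
    (F (n - k)%N * G k.+1 + F (n - k).+1 * G k).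
Proof.
have -> : \sum_(k < n.+1) 'C(n, k)%:R *
    (F (n - k)%N * G k.+1 + F (n - k).+1 * G k) =
  \sum_(k < n.+1) 'C(n, k)%:R * (F (n - k)%N * G k.+1) +
  \sum_(k < n.+1) 'C(n, k)%:R * (F (n.+1 - k)%N * G k).
  rewrite -big_split /=; apply: eq_bigr => k _.
  by rewrite mulrDr subSn // -ltnS.
rewrite big_ord_recl [in X in _ = _ + X]big_ord_recl /= !bin0 addrCA.
congr (_ + _).
transitivity (\sum_(k < n.+1) ('C(n, k)%:R * (F (n - k)%N * G k.+1)
  + 'C(n, k.+1)%:R * (F (n - k)%N * G k.+1))).
  apply: eq_bigr => k _.
  by rewrite /bump /= add1n binS natrD addrC mulrDl subSS.
rewrite big_split /=; congr (_ + _).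
rewrite big_ord_recr /= bin_small // mul0r addr0.
by apply: eq_bigr => k _; rewrite /bump /= add1n subSS.
Qed.

Lemma derive1n_mul {R : realType} {D : set R} (F G : nat -> R -> R) :
  open D ->
  (forall k x, D x -> is_derive x 1 (F k) (F k.+1 x)) ->
  (forall k x, D x -> is_derive x 1 (G k) (G k.+1 x)) ->
  forall n x, D x -> derive1n n (fun y => F 0%N y * G 0%N y) x =
    \sum_(k < n.+1) 'C(n, k)%:R * (F (n - k)%N x * G k x).
Proof.
move=> oD dF dG n x Dx.
pose H n y := \sum_(k < n.+1) 'C(n, k)%:R * (F (n - k)%N y * G k y).
have -> : (fun y => F 0%N y * G 0%N y) = H 0%N.
  by apply/funext => y; rewrite /H big_ord1 bin0 mul1r.
apply: (derive1n_seq H oD) => // {n x Dx} n x Dx.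
rewrite /H (binomial_sum_rec n (F^~ x) (G^~ x)).
rewrite (_ : (fun y => _) =
    \sum_(k < n.+1) ('C(n, k)%:R \*: (F (n - k)%N * G k))); last first.
  by apply/funext => y; rewrite fct_sumE.
apply: is_derive_sum => k; apply: is_deriveZ.
have dFk := dF (n - k)%N x Dx; have dGk := dG k x Dx.
by apply: is_derive_eq; rewrite [G k x *: _]mulrC.
Qed.

Definition falling {R : pzRingType} (s : R) (k : nat) : R :=
  \prod_(i < k) (s - i%:R).

(** The shift [c] serves both factors of the Rodrigues formula: [c = 0] for the powers of [y],
    [c = 1] for those of [1 + y]. *)
Lemma is_derive_powR_falling {R : realType} (s c : R) (k : nat) (x : R) :
  0 < c + x ->
  is_derive x 1 (fun y => falling s k * (c + y) `^ (s - k%:R))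
    (falling s k.+1 * (c + x) `^ (s - k.+1%:R)).
Proof.
move=> cx0.
have dp := @is_derive1_powR _ (s - k%:R) _ cx0.
have dc : is_derive x 1 (fun y => c + y) 1.
  rewrite (_ : (fun y => c + y) = cst c + id) //.
  by apply: is_derive_eq; rewrite add0r.
have := is_deriveZ (falling s k) (is_derive1_comp dp dc).
move/is_derive_eq; apply.
by rewrite /falling big_ord_recr /= mulr1 -mulrA -[_.+1%:R]natr1 opprD addrA.
Qed.

Lemma rodriguesM_sum {R : realType} (n : nat) (p q x : R) : 0 < x ->
  rodriguesM n p q x = (-1) ^+ n * \sum_(k < n.+1) 'C(n, k)%:R *
    (falling (n%:R + q) (n - k) * falling (n%:R - p - q) k * x ^+ k *
     (1 + x) ^+ (n - k)).
Proof.
move=> x0; rewrite /rodriguesM -mulrA; congr (_ * _).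
pose F k (y : R) := falling (n%:R + q) k * (0 + y) `^ (n%:R + q - k%:R).
pose G k (y : R) := falling (n%:R - p - q) k * (1 + y) `^ (n%:R - p - q - k%:R).
rewrite (_ : (fun y => _) = (fun y => F 0%N y * G 0%N y)); last first.
  by apply/funext => y; rewrite /F /G /falling !big_ord0 !mul1r !subr0 add0r.
have dF k (y : R) : 0 < y -> is_derive y 1 (F k) (F k.+1 y).
  by move=> y0; apply: is_derive_powR_falling; rewrite add0r.
have dG k (y : R) : 0 < y -> is_derive y 1 (G k) (G k.+1 y).
  by move=> y0; apply: is_derive_powR_falling; rewrite addr_gt0.
rewrite (derive1n_mul F G (open_gt (y := 0)) dF dG) //.
rewrite mulr_sumr; apply: eq_bigr => k _.
have x10 : 0 < 1 + x by rewrite addr_gt0.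
have kn : (k <= n)%N by rewrite -ltnS.
rewrite /F /G add0r.
(* The exponents are split so that the non-integer powers cancel against the prefactor
   [(1 + x) ^ (p + q) / x ^ q], leaving [x ^ k] and [(1 + x) ^ (n - k)]. *)
rewrite (_ : n%:R + q - (n - k)%:R = k%:R + q); last by rewrite natrB//; ring.
rewrite (_ : n%:R - p - q - k%:R = (n - k)%:R - (p + q)); last first.
  by rewrite natrB//; ring.
rewrite (@powRD _ x) ?(lt0r_neq0 x0) ?implybT//.
rewrite powRB ?(lt0r_neq0 x10) ?implybT//.
rewrite !powR_mulrn ?ltW//.
by field; rewrite !gt_eqF ?powR_gt0.
Qed.

Lemma laguerre_sum {R : realType} (n : nat) (a x : R) : 0 < x ->
  laguerre n a x = n`!%:R^-1 * \sum_(k < n.+1) 'C(n, k)%:R *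
    (falling (n%:R + a) (n - k) * (- x) ^+ k).
Proof.
move=> x0; rewrite /laguerre.
pose F k (y : R) := falling (n%:R + a) k * (0 + y) `^ (n%:R + a - k%:R).
pose G k (y : R) := (-1) ^+ k * expR (- y).
rewrite (_ : (fun y => _) = (fun y => F 0%N y * G 0%N y)); last first.
  by apply/funext => y; rewrite /F /G /falling !big_ord0 !mul1r !subr0 add0r.
have dF k (y : R) : 0 < y -> is_derive y 1 (F k) (F k.+1 y).
  by move=> y0; apply: is_derive_powR_falling; rewrite add0r.
have dG k (y : R) : 0 < y -> is_derive y 1 (G k) (G k.+1 y).
  move=> _; rewrite (_ : G k = (-1) ^+ k \*: (expR \o -%R)) //.
  by apply: is_derive_eq; rewrite /G exprSr mulrN1 mulrN1 scalerN mulNr.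
rewrite (derive1n_mul F G (open_gt (y := 0)) dF dG) //.
rewrite !mulr_sumr; apply: eq_bigr => k _.
have kn : (k <= n)%N by rewrite -ltnS.
rewrite /F /G add0r.
(* Here [x ^ a] and the exponential cancel against the prefactor; the sign [(-1) ^ k] from the
   exponential turns [x ^ k] into [(- x) ^ k]. *)
rewrite (_ : n%:R + a - (n - k)%:R = k%:R + a); last by rewrite natrB//; ring.
rewrite powRD ?(lt0r_neq0 x0) ?implybT// powRN powR_mulrn ?ltW// expRN.
rewrite [(- x) ^+ k]exprNn.
by field; rewrite !gt_eqF ?powR_gt0 ?expR_gt0// ltr0n fact_gt0.
Qed.

Lemma invr_cvgy0 {R : realType} : p^-1 @[p --> +oo] --> (0 : R).
Proof.
by apply/gtr0_cvgV0; [exact: nbhs_pinfty_gt|exact: cvg_id].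
Qed.

(** The number [k] of factors is fixed, and each factor [(b - p - i) * (t / p)] tends to [- t]. *)
Lemma falling_scaled_cvg {R : realType} (b t : R) (k : nat) :
  falling (b - p) k * (t / p) ^+ k @[p --> +oo] --> (- t) ^+ k.
Proof.
have pV := @invr_cvgy0 R.
elim: k => [|k IHk].
  rewrite (_ : (fun p => _) = cst 1); first exact: cvg_cst.
  by apply/funext => p; rewrite /falling big_ord0 mul1r.
have cvg1 : (b - k%:R) * t * p^-1 - t @[p --> +oo] --> - t.
  rewrite -[X in _ --> X]add0r -[X in X - t](mulr0 ((b - k%:R) * t)).
  by apply: cvgB; [apply: cvgM => //; exact: cvg_cst|exact: cvg_cst].
rewrite exprSr; apply: cvg_trans (cvgM IHk cvg1); apply: near_eq_cvg.
near=> p.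
have p0 : p != 0 by rewrite gt_eqF//; near: p; exact: nbhs_pinfty_gt.
by rewrite /= exprSr /falling big_ord_recr /=; field.
Unshelve. all: by end_near. Qed.

(** The quotient of [x / p] by [t / p] does not depend on [p], so only the power of [t] scales. With
    the convention [0^-1 = 0] this holds at [t = 0] too. *)
Lemma cone_harm_scale {R : realType} {d : nat} (P : multinom d -> mpoly d R)
    (k : multinom d) (x : d.-tuple R) (t p : R) : p != 0 ->
  p ^+ mdeg k * cone_harm P k (tdiv x p) (t / p) = cone_harm P k x t.
Proof.
move=> p0; rewrite /cone_harm mulrA -exprMn [p * _]mulrC divfK//.
congr (_ * peval _ _); apply: eq_from_tnth => i; rewrite !tnth_mktuple.
by rewrite invf_div mulrA mulfVK.
Qed.

(** The constant [c] allows for the shift of the first parameter on the cone; it is negligible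
    against [p] and leaves the limit unchanged. *)
Lemma rodriguesM_cvg_laguerre {R : realType} (n : nat) (c q t : R) : 0 < t ->
  rodriguesM n (p - c) q (t / p) @[p --> +oo] -->
  (-1) ^+ n * n`!%:R * laguerre n q t.
Proof.
move=> t0; rewrite laguerre_sum// mulrA mulfK; last first.
  by rewrite pnatr_eq0 -lt0n fact_gt0.
have pV := @invr_cvgy0 R.
have one_cvg j : (1 + t * p^-1) ^+ j @[p --> +oo] --> (1 : R).
  have base_cvg : 1 + t * p^-1 @[p --> +oo] --> (1 : R).
    rewrite -[X in _ --> X]addr0 -[X in _ + X](mulr0 t).
    by apply: cvgD; [exact: cvg_cst|apply: cvgM => //; exact: cvg_cst].
  rewrite -[X in _ --> X](expr1n _ j).
  exact: cvg_comp base_cvg (@exprn_continuous R j 1).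
(* Each growing falling factorial is paired with [(t / p) ^ k], and [n - (p - c) - q] is regrouped
   as [b - p] with [b = n + c - q], to match [falling_scaled_cvg]. *)
pose S p := (-1) ^+ n * \sum_(k < n.+1) 'C(n, k)%:R *
  (falling (n%:R + q) (n - k) *
   (falling (n%:R + c - q - p) k * (t / p) ^+ k) * (1 + t / p) ^+ (n - k)).
have SE : {near +oo, S =1 fun p => rodriguesM n (p - c) q (t / p)}.
  near=> p.
  have p0 : 0 < p by near: p; exact: nbhs_pinfty_gt.
  rewrite rodriguesM_sum ?divr_gt0// /S; congr (_ * _).
  apply: eq_bigr => k _; rewrite -[in RHS](mulrA (falling _ _)).
  by congr (_ * (_ * (falling _ _ * _) * _)); ring.
apply: cvg_trans (near_eq_cvg SE) _; rewrite /S.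
apply: cvgM; first exact: cvg_cst.
apply: cvg_big => [|k _]; first exact: add_continuous.
apply: cvgM; first exact: cvg_cst.
rewrite -[X in _ --> X]mulr1; apply: cvgM => //.
by apply: cvgM; [exact: cvg_cst|exact: falling_scaled_cvg].
Unshelve. all: by end_near. Qed.

Theorem theorem3p4 (R : realType) (d : nat) (mu q : R) (m n : nat)
    (P : multinom d -> mpoly d R) (k : multinom d) :
  (1 <= d)%N -> - 2^-1 < mu -> - 2 * mu - d%:R < q -> (m <= n)%N ->
  ball_orthonormal_basis mu m P -> mdeg k = m ->
  forall (x : d.-tuple R) (t : R), 0 < t ->
    p ^+ m * coneM p q mu P k n (tdiv x p) (t / p) @[p --> +oo]
    --> (-1) ^+ (n - m) * (n - m)`!%:R * coneL q mu P k n x t.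
Proof.
move=> _ _ _ _ _ <- x t t0; rewrite /coneM /coneL /=.
(* This is [2 * alpha + 2 * m], subtracted from [p] and added to [q] in [coneM]; since
   [2 * alpha = 2 * mu + d - 1], the Laguerre parameter is exactly [q + c]. *)
set c := 2 * (mu + (d%:R - 1) / 2) + 2 * (mdeg k)%:R.
have -> : 2 * (mdeg k)%:R + 2 * mu + q + d%:R - 1 = q + c by rewrite /c; field.
have cvg_rod := rodriguesM_cvg_laguerre (n - mdeg k) c (q + c) t t0.
have harm_cvg : cone_harm P k x t @[p --> +oo_R] --> cone_harm P k x t.
  exact: cvg_cst.
(* Once [p ^ m] is moved onto the harmonic factor, that factor is constant in [p] for [p != 0]. *)
rewrite mulrA; apply: cvg_trans (cvgM cvg_rod harm_cvg).
apply: near_eq_cvg; near=> p.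
have p0 : p != 0 by rewrite gt_eqF//; near: p; exact: nbhs_pinfty_gt.
by rewrite mulrCA cone_harm_scale// /= /c opprD !addrA.
Unshelve. all: by end_near. Qed.
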